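(* The topes of a tropical oriented matroid $M$ completely determine it. To be precise: let $M$ be a tropical oriented matroid with parameters $(n,d)$ and let $A=(A_1,\ldots,A_n)$ be an $(n,d)$-type. Then $A\in M$ if and only if the following two conditions hold: (i) for every tope $T$ of $M$, the comparability graph $CG_{A,T}$ is acyclic; (ii) every total refinement of $A$ is a tope of $M$.
   Context: Write $[d]=\{1,\ldots,d\}$. An $(n,d)$-type is an $n$-tuple $(A_1,\ldots,A_n)$ of nonempty subsets of $[d]$. Comparability graph: given two $(n,d)$-types $A$ and $B$, the comparability graph $CG_{A,B}$ has vertex set $[d]$; for each $1\le i\le n$, and each $j\in A_i$, $k\in B_i$, draw an edge between $j$ and $k$, which is undirected if $j,k\in A_i\cap B_i$ and directed $j\to k$ otherwise (multiple edges are allowed). A directed path from $a$ to $b$ in such a graph with directed and undirected edges is a sequence of vertices $w_0=a,w_1,\ldots,w_k=b$ and edges $e_1,\ldots,e_k$, at least one of which is directed, such that each $e_i$ is either a directed edge from $w_{i-1}$ to $w_i$ or an undirected edge joining them. A directed cycle is a directed path with identical endpoints; the graph is acyclic if it has no directed cycle. Refinement: the refinement of an $(n,d)$-type $A=(A_1,\ldots,A_n)$ with respect to an ordered partition $(P_1,\ldots,P_r)$ of $[d]$ is $B=(A_1\cap P_{m(1)},\ldots,A_n\cap P_{m(n)})$, where $m(i)$ is the largest index for which $A_i\cap P_{m(i)}$ is nonempty. A refinement $B$ is total if each $B_i$ is a singleton. A tropical oriented matroid $M$ with parameters $(n,d)$ is a collection of $(n,d)$-types satisfying: (Boundary) for each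 $j\in[d]$, the type $(j,j,\ldots,j)$ (every coordinate equal to the singleton $\{j\}$) is in $M$; (Elimination) for any $A,B\in M$ and any position $j\in[n]$ there is $C\in M$ with $C_j=A_j\cup B_j$ and $C_k\in\{A_k,B_k,A_k\cup B_k\}$ for all $k\in[n]$; (Comparability) for any $A,B\in M$ the comparability graph $CG_{A,B}$ is acyclic; (Surrounding) if $A\in M$, then every refinement of $A$ is in $M$. A tope of $M$ is a type $A=(A_1,\ldots,A_n)\in M$ such that each $A_i$ is a singleton. *)

(* Defs.v *)
From mathcomp Require Import all_boot.

Set Implicit Arguments.
Unset Strict Implicit.
Unset Printing Implicit Defensive.

(* The index sets {1, ..., n} and [d] = {1, ..., d} are 'I_n and 'I_d. *)
Definition set_tuple (n d : nat) := {ffun 'I_n -> {set 'I_d}}.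

Definition is_type n d (A : set_tuple n d) : Prop :=
  forall i : 'I_n, A i != set0.

(* CG_{A,B} is a multigraph: the triple (i, j, k) names the edge between j and
   k drawn for position i, so parallel edges stay distinct. *)
Definition cg_edge n d (A B : set_tuple n d) (e : 'I_n * 'I_d * 'I_d) : bool :=
  let: (i, j, k) := e in (j \in A i) && (k \in B i).

Definition cg_undirected n d (A B : set_tuple n d)
    (e : 'I_n * 'I_d * 'I_d) : bool :=
  let: (i, j, k) := e in (j \in A i :&: B i) && (k \in A i :&: B i).

(* The edge e can be traversed from v to w. *)
Definition cg_step n d (A B : set_tuple n d)
    (v : 'I_d) (e : 'I_n * 'I_d * 'I_d) (w : 'I_d) : bool :=
  let: (i, j, k) := e in
  cg_edge A B e &&
  (((v == j) && (w == k)) ||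
   (cg_undirected A B e && ((v == k) && (w == j)))).

(* The path has vertices w 0, ..., w l, and e i is the edge from w i to
   w i.+1; values of w and e at larger indices are irrelevant. *)
Definition directed_path n d (A B : set_tuple n d) (a b : 'I_d) : Prop :=
  exists (l : nat) (w : nat -> 'I_d) (e : nat -> 'I_n * 'I_d * 'I_d),
    [/\ w 0 = a, w l = b,
        forall i, i < l -> cg_step A B (w i) (e i) (w i.+1)
      & exists2 i, i < l & ~~ cg_undirected A B (e i)].

Definition cg_acyclic n d (A B : set_tuple n d) : Prop :=
  forall a : 'I_d, ~ directed_path A B a a.

Definition ordered_partition d (P : seq {set 'I_d}) : bool :=
  uniq P && partition [set S in P] [set: 'I_d].

(* The maximum ranges over a nonempty set of indices whenever A i is nonempty
   and P is an ordered partition. *)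
Definition refinement n d (A : set_tuple n d) (P : seq {set 'I_d}) :
    set_tuple n d :=
  [ffun i => A i :&:
     nth set0 P (\max_(m < size P | A i :&: nth set0 P m != set0) m)].

Definition all_singletons n d (A : set_tuple n d) : Prop :=
  forall i : 'I_n, exists j : 'I_d, A i = [set j].

Definition total_refinement n d (A B : set_tuple n d) : Prop :=
  (exists2 P, ordered_partition P & B = refinement A P) /\ all_singletons B.

Record tropical_oriented_matroid n d (M : {set set_tuple n d}) : Prop :=
  TropicalOrientedMatroid {
    tom_type : forall A, A \in M -> is_type A;
    tom_boundary : forall j : 'I_d, [ffun _ : 'I_n => [set j]] \in M;
    tom_elimination : forall A B, A \in M -> B \in M -> forall j : 'I_n,
      exists C, [/\ C \in M, C j = A j :|: B j
        & forall k : 'I_n, [\/ C k = A k, C k = B k | C k = A k :|: B k]];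
    tom_comparability : forall A B, A \in M -> B \in M -> cg_acyclic A B;
    tom_surrounding : forall A P, A \in M -> ordered_partition P ->
      refinement A P \in M
  }.

Definition is_tope n d (M : {set set_tuple n d}) (T : set_tuple n d) : Prop :=
  T \in M /\ all_singletons T.

(* Main.v *)
Require Import Defs.
From mathcomp Require Import all_boot.
From mathcomp Require Import zify.

(** The direct implication is comparability and surrounding.  For the converse,
    the refinements of [A] are thought of as directions: a weight [h] on [[d]]
    sends [A] to the refinement keeping in each [A_i] the elements of largest
    weight ([maximizers]), and every weight arises from an ordered partition
    ([maximizers_refinement]).

    Suppose that [A] is acyclic with every tope and that its total refinements
    are topes.  Both conditions pass to refinements of [A], so by induction on
    the sum of the [#|A_i|] all proper refinements of [A] lie in [M], and [A]
    has to be recovered from them by elimination.  A subset [S] of [[d]] cuts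
    position [i] when [A_i] meets both [S] and its complement.  Take [S]
    cutting at least one position [k], and otherwise as few as possible.
    Moving from [A] in the directions [S] and [~: S] gives two proper
    refinements, which agree with [A] at every uncut position and cover [A_k]
    together.  Eliminating between them at [k] gives [E] in [M] that is
    contained in [A] and equal to it at [k] and at every uncut position.

    If [E] differs from [A], then a set cutting fewer positions exists
    ([smaller_cut]).  Let [x] be linked to [y] when [x] is in [A_i] and [y] in
    [E_i] for some [i], that is, when an edge of CG_{A,E} leads from [x] to
    [y].  Pick [i] with [b] in [E_i] and [a] in [A_i] outside [E_i].  The set
    of vertices reachable from [b] cuts only positions where [E] and [A]
    differ, since all of [A_j] is mutually linked when [E_j = A_j].  It does
    cut [i], because [a] is not reachable from [b] ([link_not_connect]): along
    a shortest walk from [E_i] to [a], let the weight increase; the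
    corresponding total refinement of [E] is a tope whose comparability graph
    with [A] contains the walk closed up by a directed edge from [a], a
    directed cycle.  This contradicts the choice of [S], so [E = A]. *)

Set Implicit Arguments.
Unset Strict Implicit.
Unset Printing Implicit Defensive.

(** * Refinements as weight maximizers *)

Section Maximizers.

Variables n d : nat.
Implicit Types (A B D T : set_tuple n d) (h g : 'I_d -> nat) (S : {set 'I_d}).

Definition maximizers h A : set_tuple n d :=
  [ffun i => [set x in A i | [forall y in A i, h y <= h x]]].

Lemma maximizersP h A i x :
  reflect (x \in A i /\ forall y, y \in A i -> h y <= h x)
          (x \in maximizers h A i).
Proof.
rewrite ffunE inE; apply: (iffP andP) => -[xA hx]; split=> //.
  by move=> y yA; apply: (implyP (forallP hx y)).
by apply/forallP => y; apply/implyP; apply: hx.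
Qed.

Lemma maximizers_sub h A i : maximizers h A i \subset A i.
Proof. by apply/subsetP => x /maximizersP[]. Qed.

Lemma maximizer_exists h A i : is_type A -> exists x, x \in maximizers h A i.
Proof.
move=> tA; have /set0Pn[x0 x0A] := tA i.
case: (arg_maxnP (P := fun x => x \in A i) h x0A) => x xA hx.
by exists x; apply/maximizersP.
Qed.

Lemma maximizers_type h A : is_type A -> is_type (maximizers h A).
Proof. by move=> tA i; apply/set0Pn; apply: maximizer_exists. Qed.

Lemma maximizers_const A c : maximizers (fun=> c) A = A.
Proof.
by apply/ffunP => i; apply/setP => x; apply/maximizersP/idP => [[]|].
Qed.

Lemma maximizers_singletons h A :
  injective h -> is_type A -> all_singletons (maximizers h A).
Proof.
move=> h_inj tA i; have [x xM] := maximizer_exists h i tA.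
exists x; apply/setP => y; rewrite inE.
apply/idP/eqP => [yM|-> //]; apply: h_inj; apply/eqP.
have [/maximizersP[xA hx] /maximizersP[yA hy]] := (xM, yM).
by rewrite eqn_leq hx ?hy.
Qed.

(** Refining by [g] and then by [h] compares weights lexicographically; a
    multiplier of [g] above all values of [h] puts both in a single weight. *)
Lemma maximizers_comp h g A :
  exists f, maximizers h (maximizers g A) = maximizers f A.
Proof.
pose N := (\max_x h x).+1.
have hN x : h x < N by rewrite ltnS leq_bigmax.
exists (fun x => g x * N + h x); apply/ffunP => i; apply/setP => x.
apply/maximizersP/maximizersP => [[/maximizersP[xA gx] hx]|[xA fx]].
  split=> // y yA; have := gx y yA; rewrite leq_eqVlt => /orP[/eqP gxy|lt_g].
    rewrite gxy leq_add2l hx //; apply/maximizersP; split=> // z zA.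
    by rewrite gxy gx.
  by have := hN y; nia.
have gx y : y \in A i -> g y <= g x.
  by move=> yA; have := fx y yA; have := hN x; nia.
split=> [|y /maximizersP[yA gy]]; first exact/maximizersP.
have := fx y yA; have -> : g y = g x by apply/eqP; rewrite eqn_leq gx ?gy.
by rewrite leq_add2l.
Qed.

(** The ordered partition consists of the nonempty level sets of [h], by
    increasing value; it works for all [A] at once. *)
Lemma maximizers_refinement h :
  exists2 P, ordered_partition P &
    forall A, is_type A -> maximizers h A = refinement A P.
Proof.
pose vs := sort leq (undup [seq h x | x <- enum 'I_d]).
pose level v := [set x | h x == v].
have vs_uniq : uniq vs by rewrite sort_uniq undup_uniq.
have vs_sorted : sorted leq vs by apply: sort_sorted; apply: leq_total.
have vs_ltn : sorted ltn vs by rewrite ltn_sorted_uniq_leq vs_uniq.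
have h_vs x : h x \in vs.
  by rewrite mem_sort mem_undup map_f // mem_enum.
have vsP v : v \in vs -> exists x, h x = v.
  by rewrite mem_sort mem_undup => /mapP[x _ ->]; exists x.
have nth_level m : m < size vs ->
  nth set0 [seq level v | v <- vs] m = level (nth 0 vs m).
  by move=> lt_m; rewrite (nth_map 0).
exists [seq level v | v <- vs].
  apply/andP; split.
    rewrite map_inj_in_uniq // => u v /vsP[x <-] _ /setP/(_ x).
    by rewrite !inE eqxx => /esym/eqP.
  apply/and3P; split.
  - apply/eqP/setP => x; rewrite inE; apply/bigcupP.
    by exists (level (h x)); rewrite ?inE // map_f.
  - apply/trivIsetP => U V; rewrite !inE => /mapP[u _ ->] /mapP[v _ ->] neq.
    rewrite -setI_eq0; apply/eqP/setP => x; rewrite !inE.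
    by apply/andP => -[/eqP xu /eqP xv]; rewrite -xu -xv eqxx in neq.
  - rewrite !inE; apply/mapP => -[v /vsP[x <-]] /setP/(_ x).
    by rewrite !inE eqxx.
move=> A tA; apply/ffunP => i; rewrite [RHS]ffunE.
have [x xM] := maximizer_exists h i tA.
have /maximizersP[xA hx] := xM.
have lt_x : index (h x) vs < size vs by rewrite index_mem.
have lt_x' : index (h x) vs < size [seq level v | v <- vs] by rewrite size_map.
set k := \max_(m < _ | _) _.
have -> : k = index (h x) vs.
  apply/eqP; rewrite eqn_leq; apply/andP; split; last first.
    apply: (@leq_bigmax_cond _ _ _ (Ordinal lt_x')) => /=.
    by apply/set0Pn; exists x; rewrite inE xA nth_level // inE nth_index /=.
  apply/bigmax_leqP => m /set0Pn[y]; rewrite inE => /andP[yA].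
  have lt_m : m < size vs by case: m => m /=; rewrite size_map.
  rewrite nth_level // inE => /eqP hy.
  rewrite leqNgt; apply/negP => lt_xm.
  have := sorted_ltn_nth ltn_trans 0 vs_ltn (index (h x) vs) m.
  rewrite !inE nth_index // -hy => /(_ lt_x lt_m lt_xm).
  by rewrite ltnNge hx.
rewrite nth_level // nth_index //; apply/setP => y; rewrite !inE.
apply/maximizersP/andP => [[yA hy]|[yA /eqP hy]].
  by rewrite yA eqn_leq hx ?hy.
by split=> // z zA; rewrite hy hx.
Qed.

End Maximizers.

(** * Directed edges and reachability in comparability graphs *)

Section Ascent.

Variables n d : nat.
Implicit Types (A B D T : set_tuple n d).

(** These are the edges of CG_{A,T} directed because their source is not in
    [T i].  When [T] is a tope there are no other directed edges, and all
    undirected ones are loops. *)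
Definition ascent A T : rel 'I_d :=
  fun x y => [exists i, [&& x \in A i, x \notin T i & y \in T i]].

Lemma ascentP A T x y :
  reflect (exists i, [/\ x \in A i, x \notin T i & y \in T i]) (ascent A T x y).
Proof. by apply: (iffP existsP) => -[i /and3P]; exists i. Qed.

Definition ascent_acyclic A T : Prop :=
  forall x y, ascent A T x y -> ~~ connect (ascent A T) y x.

(** Monotonicity in the first argument is what lets the acyclicity condition
    pass to refinements. *)
Lemma ascent_acyclic_sub A B T :
  (forall i, B i \subset A i) -> ascent_acyclic A T -> ascent_acyclic B T.
Proof.
move=> sBA acA.
have sub x y : ascent B T x y -> ascent A T x y.
  case/ascentP=> i [xB xT yT]; apply/ascentP.
  by exists i; rewrite (subsetP (sBA i)).
move=> x y /sub/acA; apply: contra; apply: connect_sub => u v /sub.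
exact: connect1.
Qed.

Lemma directed_path_ascent A T a b p :
  ascent A T a b -> path (ascent A T) b p -> directed_path A T a (last b p).
Proof.
move=> ab bp; have [i0 _] := existsP ab.
pose w := nth a [:: a, b & p].
pose pos x y := odflt i0 [pick i | [&& x \in A i, x \notin T i & y \in T i]].
have posP x y : ascent A T x y ->
  [/\ x \in A (pos x y), x \notin T (pos x y) & y \in T (pos x y)].
  rewrite /pos => /existsP[i xy]; case: pickP => [j /and3P //|/(_ i)].
  by rewrite xy.
have step m : m < (size p).+1 -> ascent A T (w m) (w m.+1).
  have : path (ascent A T) a (b :: p) by rewrite /= ab.
  by move/(pathP a) => /(_ m).
(* Since [w m] is not in [T i], the chosen edge is directed. *)
exists (size p).+1, w, (fun m => (pos (w m) (w m.+1), w m, w m.+1)); split=> //.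
- by rewrite /w (last_nth a).
- by move=> m /step/posP[xA xT yT]; rewrite /cg_step /cg_edge xA yT !eqxx.
- exists 0 => //; have [] := posP _ _ (step 0 isT).
  by move=> _ /negPf xT _; rewrite /cg_undirected !inE xT andbF.
Qed.

Lemma cg_acyclic_ascent A T : cg_acyclic A T -> ascent_acyclic A T.
Proof.
move=> acA x y xy; apply/negP => /connectP[p yp xE].
by apply: (acA x); rewrite {2}xE; apply: directed_path_ascent.
Qed.

(** For [D] contained in [A], these are exactly the possible moves in CG_{A,D},
    directed or undirected. *)
Definition link A D : rel 'I_d :=
  fun x y => [exists i, (x \in A i) && (y \in D i)].

(** This transfers acyclicity from topes to [D].  A walk from [b] back to [a]
    would close up to a cycle in CG_{A,D}; a shortest one survives in CG_{A,T}
    for the total refinement [T] of [D] whose weight increases along the walk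
    and is smaller elsewhere.  Indeed, when a step of the walk ends at [y] in
    [D_k], no later vertex of the walk is in [D_k], as going there directly
    would be shorter; hence [T_k] is [{y}]. *)
Lemma link_not_connect A D i a b :
  (forall h : 'I_d -> nat, injective h -> ascent_acyclic A (maximizers h D)) ->
  b \in D i -> a \in A i -> a \notin D i -> ~~ connect (link A D) b a.
Proof.
move=> acA bD aA aD; apply/negP => ba.
(* The walk is minimized over all starting points in [D i], so that only the
   first vertex of the shortest one is in [D i]. *)
pose reach l := [exists b, exists p : l.-tuple 'I_d,
  [&& b \in D i, path (link A D) b p & last b p == a]].
have reachP c p : c \in D i -> path (link A D) c p -> last c p = a ->
    reach (size p).
  move=> cD cp pa; apply/existsP; exists c; apply/existsP; exists (in_tuple p).
  by rewrite cD cp pa eqxx.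
have ex_reach : exists l, reach l.
  by case/connectP: ba => p bp pa; exists (size p); apply: (reachP b).
have [l /existsP[b0 /existsP[p0 /and3P[b0D + +]]] min_l] := ex_minnP ex_reach.
move=> b0p0 /eqP p0a.
have [p [b0p uniq_p pa min_p]] : exists p, [/\ path (link A D) b0 p,
    uniq (b0 :: p), last b0 p = a &
    forall c q, c \in D i -> path (link A D) c q -> last c q = a ->
      size p <= size q].
  case/shortenP: b0p0 p0a => p b0p /= uniq_p sub_p pa.
  exists p; split=> // c q cD cq qa.
  apply: leq_trans (min_l _ (reachP c q cD cq qa)).
  rewrite -(size_tuple p0); apply: uniq_leq_size => //.
  by case/andP: uniq_p.
pose c := b0 :: p.
(* Off the walk the weight is below [d], and distinct values break ties. *)
pose h x := if x \in c then d + index x c else x.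
have h_in x : x \in c -> h x = d + index x c by rewrite /h => ->.
have h_inj : injective h.
  move=> x y; rewrite /h; case: ifP => xc; case: ifP => yc.
  - by move/addnI => xy; rewrite -(nth_index b0 xc) xy nth_index.
  - by move=> E; have := ltn_ord y; rewrite -E ltnNge leq_addr.
  - by move=> E; have := ltn_ord x; rewrite E ltnNge leq_addr.
  - exact: val_inj.
have top k m y : m < size c -> y \in D k -> y = nth b0 c m ->
    (forall z, z \in D k -> z \in c -> index z c <= m) ->
    y \in maximizers h D k.
  move=> lt_m yD yE top_m; apply/maximizersP; split=> // z zD.
  have hy : h y = d + m by rewrite h_in yE ?mem_nth // index_uniq.
  rewrite hy /h; case: ifP => [zc|_]; first by rewrite leq_add2l top_m.
  by rewrite (leq_trans (ltnW (ltn_ord z))) ?leq_addr.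
have b0T : b0 \in maximizers h D i.
  apply: (top i 0) => // z zD zc; rewrite leqNgt; apply/negP => z_gt0.
  have zp : z \in p by move: zc z_gt0; rewrite inE /= eq_sym; case: eqP.
  case/path.splitP: zp b0p pa min_p => p1 p2; rewrite cat_path last_cat last_rcons.
  move=> /andP[_ zp2] p2a /(_ z p2 zD zp2 p2a).
  by rewrite size_cat size_rcons addSn ltnNge leq_addl.
have ab0 : ascent A (maximizers h D) a b0.
  apply/ascentP; exists i; split=> //.
  by apply: contra aD => /maximizersP[].
have := acA h h_inj a b0 ab0; apply/negP; rewrite negbK.
apply/connectP; exists p => //; apply/(pathP b0) => m lt_m.
have /(pathP b0)/(_ m lt_m)/existsP[k /andP[xA yD]] := b0p.
have yT : nth b0 p m \in maximizers h D k.
  apply: (top k m.+1) => // z zD zc; rewrite leqNgt; apply/negP => lt_z.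
  pose m' := (index z c).-1.
  have mE : m'.+1 = index z c by rewrite prednK // (leq_trans _ lt_z).
  have lt_m' : m' < size p by rewrite -ltnS mE -[(size p).+1]/(size c) index_mem.
  have zE : z = nth b0 p m' by rewrite -(nth_index b0 zc) -mE.
  (* Jump from the current vertex to [z], skipping what lies between. *)
  pose q := take m p ++ drop m' p.
  have : size p <= size q.
    apply: (min_p b0) => //.
      move: (b0p); rewrite -{1}(cat_take_drop m p) cat_path => /andP[b0m _].
      rewrite /q cat_path b0m /= (drop_nth b0) //= -zE.
      apply/andP; split.
        apply/existsP; exists k; rewrite zD andbT.
        rewrite (last_nth b0) size_takel ?(ltnW lt_m) //.
        by rewrite -[_ :: _]/(take m.+1 c) nth_take.
      move: (b0p); rewrite -{1}(cat_take_drop m' p) cat_path (drop_nth b0) //=.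
      by rewrite -zE => /and3P[].
    move: pa; rewrite -{1}(cat_take_drop m' p) /q !last_cat.
    by rewrite (drop_nth b0 lt_m').
  rewrite size_cat size_takel ?(ltnW lt_m) // size_drop leqNgt.
  by rewrite -[ltnRHS](subnKC (ltnW lt_m')) ltn_add2r -ltnS mE lt_z.
apply/ascentP; exists k; split=> //.
apply/negP => /maximizersP[xD hx].
have := hx _ yD; have yE : nth b0 p m = nth b0 c m.+1 by [].
have lt_m1 : m < size c by apply: ltnW.
by rewrite yE !h_in ?mem_nth // !index_uniq // leq_add2l ltnn.
Qed.

End Ascent.

(** * Cuts and the recovery of a type from its refinements *)

Section TropicalOrientedMatroid.

Variables n d : nat.
Implicit Types (A B D T : set_tuple n d) (S : {set 'I_d}).

Definition cuts S A : {set 'I_n} :=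
  [set i | (A i :&: S != set0) && (A i :\: S != set0)].

Lemma cutsC S A : cuts (~: S) A = cuts S A.
Proof. by apply/setP => i; rewrite !inE setDE setCK -setDE andbC. Qed.

(** The refinement for the ordered partition (~: S, S): it is [A i :&: S] where
    this is nonempty, and [A i] elsewhere. *)
Definition slice S A : set_tuple n d :=
  maximizers (fun x => nat_of_bool (x \in S)) A.

Lemma mem_slice S A i x : x \in A i -> x \in S -> x \in slice S A i.
Proof.
by move=> xA xS; apply/maximizersP; rewrite xS; split=> // y _; case: (y \in S).
Qed.

Lemma sliceU S A i : slice S A i :|: slice (~: S) A i = A i.
Proof.
apply/eqP; rewrite eqEsubset subUset !maximizers_sub /=.
apply/subsetP => x xA; rewrite inE; case: (boolP (x \in S)) => xS.
  by rewrite mem_slice.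
by rewrite orbC mem_slice // inE.
Qed.

Lemma slice_uncut S A i : i \notin cuts S A -> slice S A i = A i.
Proof.
rewrite inE negb_and !negbK => uncut.
apply/eqP; rewrite eqEsubset maximizers_sub; apply/subsetP => x xA.
apply/maximizersP; split=> // y yA.
case/orP: uncut => /eqP/setP E.
  by move: (E y); rewrite !inE yA /= => ->.
by move: (E x); rewrite !inE xA andbT /= => /negbFE ->; case: (y \in S).
Qed.

Lemma slice_cut S A i : i \in cuts S A -> slice S A i \proper A i.
Proof.
rewrite inE => /andP[/set0Pn[x]]; rewrite inE => /andP[xA xS].
case/set0Pn=> y; rewrite inE => /andP[yS yA].
rewrite properE maximizers_sub; apply/subsetPn; exists y => //.
by apply/maximizersP => -[_ /(_ x xA)]; rewrite xS (negPf yS).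
Qed.

Lemma sum_card_slice S A i :
  i \in cuts S A -> \sum_j #|slice S A j| < \sum_j #|A j|.
Proof.
move=> iS; rewrite (bigD1 i) //= [ltnRHS](bigD1 i) //= -addSn leq_add //.
  exact/proper_card/slice_cut.
by apply: leq_sum => j _; apply/subset_leq_card/maximizers_sub.
Qed.

Variable M : {set set_tuple n d}.
Hypothesis hM : tropical_oriented_matroid M.

Lemma tom_maximizers h A : A \in M -> maximizers h A \in M.
Proof.
have [P ordP PE] := maximizers_refinement n h.
move=> AM; rewrite PE; last exact: tom_type AM.
exact: tom_surrounding.
Qed.

Definition compatible A : Prop := forall T, is_tope M T -> ascent_acyclic A T.

Definition refines_to_topes A : Prop :=
  forall h, all_singletons (maximizers h A) -> maximizers h A \in M.

Lemma refines_to_topes_maximizers g A :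
  refines_to_topes A -> refines_to_topes (maximizers g A).
Proof. by move=> topA h; have [f ->] := maximizers_comp h g A; apply: topA. Qed.

(** The cut is the set of vertices reachable in the link relation from some
    [b] in [D k]: where [D i = A i], any two elements of [A i] are linked both
    ways, so such a position is never cut, whereas [k] is cut because no
    element of [A k] outside [D k] is reachable. *)
Lemma smaller_cut A D k :
  compatible A -> D \in M -> (forall i, D i \subset A i) ->
  D k != A k ->
  exists2 S, k \in cuts S A & cuts S A \subset [set i | D i != A i].
Proof.
move=> compA DM sDA neqk.
have [b bD] := set0Pn _ (tom_type hM DM k).
have /subsetPn[a aA aD] : ~~ (A k \subset D k).
  by apply: contra neqk; rewrite eqEsubset sDA.
exists [set x | connect (link A D) b x].
  rewrite inE; apply/andP; split; apply/set0Pn.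
    by exists b; rewrite !inE connect0 andbT (subsetP (sDA k)).
  exists a; rewrite !inE aA andbT; apply: link_not_connect bD aA aD.
  move=> h h_inj; apply: compA; split; first exact: tom_maximizers.
  by apply: maximizers_singletons => //; apply: tom_type DM.
apply/subsetP => i; rewrite !inE => /andP[/set0Pn[x]].
rewrite !inE => /andP[xA bx] /set0Pn[y]; rewrite !inE => /andP[by' yA].
apply: contra by' => /eqP DA; apply: connect_trans bx _; apply: connect1.
by apply/existsP; exists i; rewrite xA DA.
Qed.

(** The induction is on the total size of [A]; a position cut by the fewest
    possible is where elimination is applied. *)
Lemma tope_criterion A :
  is_type A -> compatible A -> refines_to_topes A -> A \in M.
Proof.
have [m] := ubnP (\sum_i #|A i|); elim: m A => // m IH A le_m tA compA topA.
have [/forallP triv|] := boolP [forall i, #|A i| <= 1].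
  rewrite -(maximizers_const A 0); apply: topA; rewrite maximizers_const => i.
  by apply/cards1P; rewrite eqn_leq triv card_gt0 tA.
rewrite negb_forall => /existsP[j]; rewrite -ltnNge => /card_gt1P[x [y]].
case=> xA yA neq_xy.
have cut_x : cuts [set x] A != set0.
  apply/set0Pn; exists j; rewrite inE; apply/andP; split; apply/set0Pn.
    by exists x; rewrite !inE xA eqxx.
  by exists y; rewrite !inE yA eq_sym neq_xy.
have [S /set0Pn[k kS] min_S] :=
  arg_minnP (P := fun S => cuts S A != set0) (fun S => #|cuts S A|) cut_x.
have slice_in U : k \in cuts U A -> slice U A \in M.
  move=> kU; apply: IH.
  - exact: leq_trans (sum_card_slice kU) _.
  - exact: maximizers_type.
  - move=> T /compA; apply: ascent_acyclic_sub => i; exact: maximizers_sub.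
  - exact: refines_to_topes_maximizers.
have BM := slice_in S kS.
have CM : slice (~: S) A \in M by apply: slice_in; rewrite cutsC.
have [E [EM Ek Ei]] := tom_elimination hM BM CM k.
have sEA i : E i \subset A i.
  by case: (Ei i) => ->; rewrite ?sliceU ?maximizers_sub.
have Euncut i : i \notin cuts S A -> E i = A i.
  move=> iS; have iS' : i \notin cuts (~: S) A by rewrite cutsC.
  by case: (Ei i) => ->; rewrite ?(slice_uncut iS) ?(slice_uncut iS') ?setUid.
suff -> : A = E by [].
apply/ffunP => i; apply/eqP; rewrite eq_sym; apply/negPn/negP => neqi.
have [U iU sU] := smaller_cut compA EM sEA neqi.
have /min_S : cuts U A != set0 by apply/set0Pn; exists i.
rewrite leqNgt => /negP[]; apply: proper_card.
rewrite properE; apply/andP; split.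
  apply: subset_trans sU _; apply/subsetP => l; rewrite inE.
  by apply: contraR => /Euncut ->.
apply/subsetPn; exists k => //.
by apply/negP => /(subsetP sU); rewrite inE Ek sliceU eqxx.
Qed.

End TropicalOrientedMatroid.

Theorem theorem4p4 (n d : nat) (M : {set set_tuple n d})
    (hM : tropical_oriented_matroid M)
    (A : set_tuple n d) (hA : is_type A) :
  A \in M <->
  (forall T : set_tuple n d, is_tope M T -> cg_acyclic A T) /\
  (forall B : set_tuple n d, total_refinement A B -> is_tope M B).
Proof.
split=> [AM|[compA topA]].
  split=> [T [TM _]|B [[P ordP ->] sB]]; last first.
    by split=> //; apply: tom_surrounding.
  exact: (tom_comparability hM AM TM).
apply: (tope_criterion hM) => // [T topeT|h sB].
  by apply: cg_acyclic_ascent; apply: compA.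
have [P ordP PE] := maximizers_refinement n h.
have totB : total_refinement A (maximizers h A).
  by split=> //; exists P => //; apply: PE.
by have [] := topA _ totB.
Qed.
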